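(* Let $A$ be a uniform algebra on a compact Hausdorff space $X$ and let $y\in X$. Let $F_y=\{x\in X: J_x\subseteq M_y\}$. Then either $y$ is a point of continuity (i.e. $F_y=\{y\}$), or $F_y$ has a non-empty, perfect subset.
   Context: A uniform algebra on a compact Hausdorff space $X$ is a uniformly closed subalgebra of $C(X)$ (continuous complex-valued functions) which contains the constants and separates the points of $X$; $X$ need not be the whole character space of $A$. For $x\in X$: $M_x=\{f\in A: f(x)=0\}$, and $J_x$ is the ideal of those $f\in A$ vanishing on some neighbourhood of $x$ in $X$. A perfect set is a closed set with no isolated points (in its relative topology). *)

(* Defs.v *)
From HB Require Import structures.
From mathcomp Require Import all_boot all_order all_algebra.
From mathcomp Require Import complex.
From mathcomp Require Import all_classical all_reals all_analysis.
Import Order.TTheory GRing.Theory Num.Theory.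
Import numFieldNormedType.Exports.
Set Implicit Arguments.
Unset Strict Implicit.
Unset Printing Implicit Defensive.
Local Open Scope complex_scope.
Local Open Scope classical_set_scope.
Local Open Scope ring_scope.

(* The topology and norm on R[i] are those of the numFieldType R[i]; they are
   attached to the alias R[i]^o, hence its use throughout. *)

Section UniformAlgebra.
Variables (R : realType) (X : topologicalType).
Implicit Types (A : set (X -> R[i]^o)) (x y : X).

(* Closure under scalar multiplication follows from ua_cst and ua_mul. Since a
   uniform limit of continuous functions is continuous, being closed in C(X) and
   being closed among all functions for the uniform topology are the same. *)
Record is_uniform_algebra A : Prop := IsUniformAlgebra {
  ua_continuous : forall f, A f -> continuous f;
  ua_cst : forall c : R[i], A (fun=> c);
  ua_add : forall f g, A f -> A g -> A (fun x => f x + g x);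
  ua_mul : forall f g, A f -> A g -> A (fun x => f x * g x);
  ua_closed : closed (A : set {uniform X -> R[i]^o});
  ua_separates : forall x y, x <> y -> exists2 f, A f & f x <> f y
}.

Definition ideal_M A x : set (X -> R[i]^o) := [set f | A f /\ f x = 0].

Definition ideal_J A x : set (X -> R[i]^o) :=
  [set f | A f /\ \forall z \near x, f z = 0].

Definition F_set A y : set X := [set x | ideal_J A x `<=` ideal_M A y].

Definition point_of_continuity A y : Prop := F_set A y = [set y].

End UniformAlgebra.

(* Main.v *)
Require Import Defs.
From mathcomp Require Import all_boot all_order all_algebra.
From mathcomp Require Import complex.
From mathcomp Require Import all_classical all_reals all_analysis.
From mathcomp Require Import ring lra.
Import Order.TTheory GRing.Theory Num.Theory.
Import numFieldNormedType.Exports.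
Import ComplexField.Normc.
Set Implicit Arguments.
Unset Strict Implicit.
Unset Printing Implicit Defensive.
Local Open Scope complex_scope.
Local Open Scope classical_set_scope.
Local Open Scope ring_scope.

(* Let [x <> y] lie in [F_y] and take [g] in [A] with [g x = 0], [g y = 1]. If [Re g] maps
   [F_y] onto a set containing [[0, 1]], then a minimal closed subset of [F_y] with this
   property has no isolated point, since removing one point from [[0, 1]] leaves a dense
   subset. Otherwise [Re g] omits some [t] of [[0, 1]] on [F_y]. Put [w = g - t].
   Compactness yields [f] in [A] with [f y <> 0] such that [|Re w|] is bounded below on
   [K = {f <> 0}]. The uniform closure of [A] on [K] then contains the sign of [Re w]: it
   is the limit of the Newton iteration [u -> (u + 1/u) / 2] started at [w]. Hence
   [f * (1 + sg (Re w))] is in [A], vanishes near [x], but not at [y]: a contradiction. *)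

(** * Compactness and perfect subsets *)

(** If [Q] failed on the whole space, the complements of the sets satisfying [Q] would form a proper
    filter. A cluster point of it cannot have a neighbourhood satisfying [Q]. This stands in for
    extracting finite subcovers. *)
Lemma compact_local_global (T : topologicalType) (Q : set T -> Prop) :
    compact [set: T] -> Q set0 ->
    (forall S S', S `<=` S' -> Q S' -> Q S) ->
    (forall S S', Q S -> Q S' -> Q (S `|` S')) ->
    (forall z : T, exists2 S, nbhs z S & Q S) ->
  Q [set: T].
Proof.
move=> cT Q0 Qsub QU Qloc; apply: contrapT => QT.
pose F : set_system T := [set S | Q (~` S)].
have FF : ProperFilter F.
  split; first by rewrite /F /= setC0.
  split.
  - by rewrite /F /= setCT.
  - by move=> S S' QS QS'; rewrite /F /= setCI; exact: QU.
  - by move=> S S' SS' ; apply: Qsub; exact: subsetC.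
have [|z [_ Fz]] := cT F FF; first by rewrite /F /= setCT.
have [S zS QS] := Qloc z.
have FS : F (~` S) by rewrite /F /= setCK.
by have [x []] := Fz _ _ FS zS.
Qed.

Lemma nbhs_itv_neq (R : realType) (a b r : R) (W : set R) :
    a < b -> `[a, b]%classic r -> nbhs r W ->
  exists2 r', `[a, b]%classic r' & W r' /\ r' <> r.
Proof.
move=> ab; rewrite /= in_itv /= => /andP[ar rb] /nbhs_ballP[e /= e0 eW].
have [rltb|br] := ltP r b.
  exists (r + Num.min (e / 2) (b - r)).
    by rewrite /= in_itv /=; case: (leP (e / 2)); lra.
  have m0 : 0 < Num.min (e / 2) (b - r) by rewrite lt_min; lra.
  split; last lra.
  apply: eW; rewrite /ball /= opprD addrA subrr sub0r normrN gtr0_norm //.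
  by rewrite gt_min; lra.
exists (r - Num.min (e / 2) (r - a)).
  by rewrite /= in_itv /=; case: (leP (e / 2)); lra.
have m0 : 0 < Num.min (e / 2) (r - a) by rewrite lt_min; lra.
split; last lra.
apply: eW; rewrite /ball /= opprB addrC subrK gtr0_norm //.
by rewrite gt_min; lra.
Qed.

Lemma perfect_subset_of_image_itv (R : realType) (T : topologicalType)
    (phi : T -> R) (F : set T) (a b : R) :
    hausdorff_space T -> compact [set: T] -> continuous phi -> closed F ->
    a < b -> `[a, b]%classic `<=` phi @` F ->
  exists P : set T, [/\ P `<=` F, P !=set0 & perfect_set P].
Proof.
move=> hT cT cphi cF ab abF.
(* A minimal closed set is found as [F] minus a maximal removable open set, so that Zorn's lemma is
   applied to unions. *)
pose C : set (set T) := [set U | open U /\ `[a, b]%classic `<=` phi @` (F `\` U)].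
have [D DC Dtot|U [[oU abU] Umax]] := @Zorn_bigcup T C.
  split; first by apply: bigcup_open => U /DC[].
  move=> r abr; apply: contrapT => noz.
  (* If the union of the chain contained the fibre of [r] in [F], then by compactness a single
     member would contain it. The first alternative, where [S] misses the fibre, also covers the
     empty chain. *)
  pose Q S := (forall z, S z -> F z -> phi z <> r) \/
    exists2 U, D U & (S `&` F `&` [set z | phi z = r] `<=` U).
  have /= : Q [set: T].
    apply: compact_local_global => //.
    - by left.
    - move=> S S' SS' [h|[U DU h]]; first by left=> z /SS'; exact: h.
      by right; exists U => // z [[/SS' ? ?] ?]; exact: h.
    - move=> S S' [h|[U DU h]] [h'|[U' DU' h']].
      + by left=> z []; [exact: h|exact: h'].
      + right; exists U' => // z [[[Sz|Sz] Fz] rz]; last exact: h'.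
        by have := h _ Sz Fz.
      + right; exists U => // z [[[Sz|Sz] Fz] rz]; first exact: h.
        by have := h' _ Sz Fz.
      + have [UU'|U'U] := Dtot _ _ DU DU'; right.
        * exists U' => // z [[[Sz|Sz] Fz] rz]; last exact: h'.
          by apply: UU'; exact: h.
        * exists U => // z [[[Sz|Sz] Fz] rz]; first exact: h.
          by apply: U'U; exact: h'.
    - move=> z; have [Fz|Fz] := pselect (F z); last first.
        exists (~` F); last by left.
        by apply: open_nbhs_nbhs; split; [exact: closed_openC|].
      have [rz|rz] := pselect (phi z = r); last first.
        exists (phi @^-1` (~` [set r])); last by left.
        apply: open_nbhs_nbhs; split => //; apply: open_comp; first by [].
        by apply: closed_openC; exact: closed_eq.
      have [U DU Uz] : exists2 U, D U & U z.
        by apply: contrapT => nU; apply: noz; exists z.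
      exists U; last by right; exists U => // u [[]].
      by apply: open_nbhs_nbhs; split => //; have [] := DC _ DU.
  case=> [h|[U DU h]].
  - have [z Fz rz] := abF r abr.
    by apply: (h z).
  - have [_ /(_ r abr)[z [Fz nUz] rz]] := DC _ DU.
    by apply: nUz; apply: h.
exists (F `\` U).
have cP : closed (F `\` U) by apply: closedI => //; exact: open_closedC.
split; first by move=> z [].
  by have [|z Pz _] := abU a; [rewrite /= in_itv /= lexx ltW|exists z].
split => //; apply/seteqP; split.
  by move=> z /subset_limit_point; exact: cP.
move=> p Pp; apply: contrapT => np.
have [V Vp VP] : exists2 V, nbhs p V & forall z, V z -> (F `\` U) z -> z = p.
  apply: contrapT => nV; apply: np => V Vp; apply: contrapT => nz.
  apply: nV; exists V => // z Vz Pz; apply: contrapT => zp; apply: nz.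
  by exists z; split => //; apply/eqP.
pose V' := interior V.
have oV' : open V' by exact: open_interior.
have V'p : V' p by [].
have V'V : V' `<=` V by exact: interior_subset.
(* Adding [V'] to [U] removes only the isolated point [p], so maximality is contradicted once the
   image still covers the interval. *)
apply: (Umax (U `|` V')); last first.
  split; first exact: openU.
  pose P' := F `\` (U `|` V').
  have cP' : compact P'.
    apply: (subclosed_compact _ cT) => //.
    by apply: closedI => //; apply: open_closedC; exact: openU.
  have clP' : closed (phi @` P').
    apply: compact_closed; first exact: Rhausdorff.
    by apply: continuous_compact cP'; exact: continuous_subspaceT.
  (* The remaining image is closed, so density in the interval is enough. Only the value [phi p] can
     be lost, and it is a limit of other points of the interval. *)
  move=> r abr; apply: clP' => W Wr.
  have [r' abr' [Wr' r'p]] : exists2 r', `[a, b]%classic r' & W r' /\ r' <> phi p.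
    have [rp|?] := pselect (r = phi p); last first.
      by exists r => //; split => //; exact: nbhs_singleton.
    rewrite -rp; exact: nbhs_itv_neq.
  have [z Pz zr'] := abU r' abr'.
  exists r'; split => //; exists z => //; case: Pz => Fz nUz; split => // -[//|V'z].
  by apply: r'p; rewrite -zr'; congr phi; apply: VP => //; exact: V'V.
rewrite properEneq; split => //.
by apply/eqP => UU; case: Pp => _; apply; rewrite UU; right.
Qed.

(** * The real-valued modulus [normc], to which estimates in [R[i]] are reduced *)

Section ComplexModulus.
Variable R : rcfType.
Implicit Types x y z : R[i].

Lemma complex_normE z : `|z| = (normc z)%:C.
Proof. by rewrite normc_def; case: z. Qed.

Lemma normc_sqr z : normc z ^+ 2 = complex.Re z ^+ 2 + complex.Im z ^+ 2.
Proof. by case: z => a b; rewrite /= sqr_sqrtr // addr_ge0 ?sqr_ge0. Qed.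

Lemma normc_ge0 z : 0 <= normc z.
Proof. by case: z => a b; exact: sqrtr_ge0. Qed.

Lemma ler_normcD x y : normc (x + y) <= normc x + normc y.
Proof. exact: le_normcD. Qed.

Lemma normc_opp z : normc (- z) = normc z.
Proof. exact: normcN. Qed.

Lemma normc_real (a : R) : normc a%:C = `|a|.
Proof. by rewrite /= expr0n addr0 sqrtr_sqr. Qed.

Lemma normcX z n : normc (z ^+ n) = normc z ^+ n.
Proof. by elim: n => [|n IH]; rewrite ?expr0 ?normc1 // !exprS normcM IH. Qed.

Lemma ler_Re_normc z : `|complex.Re z| <= normc z.
Proof.
by rewrite -ler_sqr ?nnegrE ?normc_ge0 // normc_sqr real_normK ?num_real //
  lerDl sqr_ge0.
Qed.

End ComplexModulus.

Lemma exists_expr_lt (R : realType) (r e : R) : 0 <= r < 1 -> 0 < e ->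
  exists n, r ^+ n < e.
Proof.
move=> /andP[r0 r1] e0.
have /cvg_expr/cvgr0Pnorm_lt/(_ _ e0)[n _ /(_ n (leqnn n))] : `|r| < 1.
  by rewrite ger0_norm.
by rewrite ger0_norm ?exprn_ge0 // => rn; exists n.
Qed.

(** * Newton iteration for the square roots of 1 *)

Section NewtonSign.
Variable R : realType.
Implicit Types (u w : R[i]) (s : R).

Lemma complex_neq0_Re u : complex.Re u != 0 -> u != 0.
Proof. by apply: contraNneq => ->. Qed.

(** The step multiplies the real part by [(1 + 1 / |u|^2) / 2], which exceeds 1/2. Hence every
    iterate stays off the imaginary axis, on the same side. *)
Lemma Re_newton_step u : complex.Re u != 0 ->
  `|complex.Re u| / 2 <= `|complex.Re ((u + u^-1) / 2%:R)| /\
  Num.sg (complex.Re ((u + u^-1) / 2%:R)) = Num.sg (complex.Re u).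
Proof.
move=> a0; set n := complex.Re u ^+ 2 + complex.Im u ^+ 2.
have n0 : 0 < n by rewrite ltr_wpDr ?sqr_ge0 // exprn_even_gt0.
have -> : complex.Re ((u + u^-1) / 2%:R) = complex.Re u * ((1 + n^-1) / 2).
  have -> : 2%:R^-1 = (2^-1)%:C :> R[i] by rewrite rmorphV ?unitfE ?pnatr_eq0 // rmorphMn.
  rewrite /n; case: (u) => a b /=; rewrite mulr0 subr0; ring.
have i0 : 0 < n^-1 by rewrite invr_gt0.
set c := (1 + _) / 2.
have c2 : 1 / 2 <= c by rewrite /c; lra.
have c0 : 0 < c by lra.
rewrite sgrM (gtr0_sg c0) mulr1 normrM (gtr0_norm c0); split => //.
by have := normr_ge0 (complex.Re u); nra.
Qed.

(** The step squares the Cayley quotient [(u - s) / (u + s)], because it sends [u - s] to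
    [(u - s)^2 / (2 u)] and [u + s] to [(u + s)^2 / (2 u)]. The bound is kept multiplied out to
    avoid dividing by [u + s]. *)
Lemma newton_step_contract u s r : s ^+ 2 = 1 -> u != 0 -> 0 <= r ->
  normc (u - s%:C) <= r * normc (u + s%:C) ->
  normc ((u + u^-1) / 2%:R - s%:C) <= r ^+ 2 * normc ((u + u^-1) / 2%:R + s%:C).
Proof.
move=> s2 u0 r0 h.
have sC2 : s%:C ^+ 2 = 1 :> R[i] by rewrite -rmorphXn /= s2.
have u20 : (2%:R * u) != 0 by rewrite mulf_neq0 // pnatr_eq0.
have -> : (u + u^-1) / 2%:R - s%:C = (u - s%:C) ^+ 2 / (2%:R * u).
  rewrite sqrrB sC2; field.
  by rewrite u0.
have -> : (u + u^-1) / 2%:R + s%:C = (u + s%:C) ^+ 2 / (2%:R * u).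
  rewrite sqrrD sC2; field.
  by rewrite u0.
rewrite ![normc (_ / _)]normcM mulrA ler_wpM2r ?normc_ge0 // !normcX -exprMn.
by rewrite lerXn2r ?nnegrE ?mulr_ge0 ?normc_ge0.
Qed.

(** With [s] the sign of [Re w], [|w + s|^2 - |w - s|^2 = 4 |Re w| >= 4 d], while [|w + s|] is
    bounded. So the quotient of the moduli stays below a constant less than 1, uniformly in [w]. *)
Lemma newton_start (d M : R) : 0 < d -> exists2 r, 0 <= r < 1 &
  forall w, d <= `|complex.Re w| -> normc w <= M ->
    normc (w - (Num.sg (complex.Re w))%:C) <=
    r * normc (w + (Num.sg (complex.Re w))%:C).
Proof.
move=> d0; pose L := `|M| + 1 + 4 * d.
(* In [L], the part [|M| + 1] bounds [|w + s|], and the extra [4 * d] forces [4 * d < L ^+ 2]. *)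
have M0 := normr_ge0 M.
have L0 : 0 < L by rewrite /L; lra.
have L2 : 4 * d / L ^+ 2 < 1.
  by rewrite ltr_pdivrMr ?exprn_gt0 // mul1r /L; nra.
have q0 : 0 < 4 * d / L ^+ 2 by rewrite divr_gt0 ?exprn_gt0 //; lra.
exists (Num.sqrt (1 - 4 * d / L ^+ 2)).
  rewrite sqrtr_ge0 /= -[ltRHS]sqrtr1 ltr_sqrt //; lra.
move=> w dw wM; set s := Num.sg _.
have s2 : s ^+ 2 = 1.
  by rewrite sqr_sg -normr_gt0 (lt_le_trans d0 dw).
have sn : normc s%:C = 1.
  by rewrite normc_real -sqrtr_sqr s2 sqrtr1.
have wL : normc (w + s%:C) <= L.
  have := ler_normcD w s%:C; rewrite sn /L.
  by have := ler_norm M; lra.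
rewrite -ler_sqr ?nnegrE ?mulr_ge0 ?normc_ge0 ?sqrtr_ge0 //.
rewrite exprMn sqr_sqrtr; last lra.
have -> : normc (w - s%:C) ^+ 2 = normc (w + s%:C) ^+ 2 - 4 * (complex.Re w * s).
  by rewrite !normc_sqr; case: (w) => a b /=; rewrite !oppr0 !addr0; ring.
have -> : complex.Re w * s = `|complex.Re w| by rewrite mulrC -normrEsg.
rewrite mulrBl mul1r lerD2l lerN2 mulrAC ler_pdivrMr ?exprn_gt0 //.
have : normc (w + s%:C) ^+ 2 <= L ^+ 2.
  by rewrite lerXn2r ?nnegrE ?normc_ge0 // ltW.
have : 0 <= L ^+ 2 by rewrite sqr_ge0.
by nra.
Qed.

End NewtonSign.

(** * Uniform approximation on a set by an algebra of functions *)

Section Approximation.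
Variables (R : realType) (T : Type) (A : set (T -> R[i])) (K : set T).
Hypotheses (Acst : forall c : R[i], A (fun=> c))
  (Aadd : forall f g, A f -> A g -> A (fun x => f x + g x))
  (Amul : forall f g, A f -> A g -> A (fun x => f x * g x))
  (Abnd : forall f, A f -> exists M : R, forall x, K x -> normc (f x) <= M).
Implicit Types f g h w : T -> R[i].

(** Membership in the uniform closure of the restrictions of [A] to [K]. Values of [h] off [K] are
    irrelevant, so totalised inverses do no harm there. *)
Definition approximable h := forall e : R, 0 < e ->
  exists2 f, A f & forall x, K x -> normc (h x - f x) <= e.

Lemma approximable_in f : A f -> approximable f.
Proof. by move=> Af e /ltW e0; exists f => // x _; rewrite subrr normc0. Qed.

Lemma approximable_lim h :
  (forall e : R, 0 < e ->
     exists2 g, approximable g & forall x, K x -> normc (h x - g x) <= e) ->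
  approximable h.
Proof.
move=> hl e e0; have e20 : 0 < e / 2 by lra.
have [g /(_ _ e20)[f Af gf] hg] := hl _ e20.
exists f => // x Kx; rewrite -(subrK (g x) (h x)) -addrA.
by have := ler_normcD (h x - g x) (g x - f x); have := hg x Kx; have := gf x Kx; lra.
Qed.

Lemma eq_approximable h h' : (forall x, K x -> h x = h' x) ->
  approximable h -> approximable h'.
Proof.
move=> hh' ah; apply: approximable_lim => e /ltW e0.
by exists h => // x /hh' ->; rewrite subrr normc0.
Qed.

Lemma approximable_bounded h : approximable h ->
  exists2 M : R, 0 < M & forall x, K x -> normc (h x) <= M.
Proof.
move=> /(_ 1 ltr01)[f /Abnd[M fM] hf].
exists (`|M| + 1) => [|x Kx]; first by rewrite ltr_wpDl.
have := ler_normcD (h x - f x) (f x); rewrite subrK.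
by have := hf x Kx; have := fM x Kx; have := ler_norm M; lra.
Qed.

Lemma approximable_cst (c : R[i]) : approximable (fun=> c).
Proof. exact: approximable_in. Qed.

Lemma approximable_add g h : approximable g -> approximable h ->
  approximable (fun x => g x + h x).
Proof.
move=> ag ah e e0; have e20 : 0 < e / 2 by lra.
have [[f Af gf] [f' Af' hf']] := (ag _ e20, ah _ e20).
exists (fun x => f x + f' x) => [|x Kx]; first exact: Aadd.
have -> : g x + h x - (f x + f' x) = (g x - f x) + (h x - f' x) by ring.
have := ler_normcD (g x - f x) (h x - f' x).
by have := gf x Kx; have := hf' x Kx; lra.
Qed.

Lemma approximable_mul g h : approximable g -> approximable h ->
  approximable (fun x => g x * h x).
Proof.
move=> ag ah.
have [M M0 gM] := approximable_bounded ag.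
(* One factor is approximated at a time: first [h] by some [f] in [A], using the bound on [g], then
   [g] with a precision that depends on the bound for [f]. *)
apply: approximable_lim => e e0.
have [f Af hf] : exists2 f, A f & forall x, K x -> normc (h x - f x) <= e / M.
  by apply: ah; rewrite divr_gt0.
exists (fun x => g x * f x).
  have [N fN] := Abnd Af.
  have N0 : 0 < `|N| + 1 by rewrite ltr_wpDl.
  move=> e' e'0.
  have [f' Af' gf'] : exists2 f', A f' &
      forall x, K x -> normc (g x - f' x) <= e' / (`|N| + 1).
    by apply: ag; rewrite divr_gt0.
  exists (fun x => f' x * f x) => [|x Kx]; first exact: Amul.
  rewrite -mulrBl normcM -(divfK (lt0r_neq0 N0) e') ler_pM ?normc_ge0 ?gf' //.
  by have := fN x Kx; have := ler_norm N; lra.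
move=> x Kx; rewrite -mulrBr normcM mulrC -(divfK (lt0r_neq0 M0) e).
by rewrite ler_pM ?normc_ge0 ?hf ?gM.
Qed.

Lemma approximable_sumX h n : approximable h ->
  approximable (fun x => \sum_(i < n) h x ^+ i).
Proof.
move=> ah; elim: n => [|n IH].
  apply: (eq_approximable _ (approximable_cst 0)) => x _.
  by rewrite big_ord0.
apply: (eq_approximable _
  (approximable_add (approximable_cst 1) (approximable_mul ah IH))) => x _.
rewrite big_ord_recl expr0 mulr_sumr; congr (_ + _).
by apply: eq_bigr => i _; rewrite exprS.
Qed.

(** Geometric series in [1 - h]: the remainder after [n] terms is [(1 - h)^n / h], of modulus at
    most [r^n / (1 - r)]. *)
Lemma approximable_inv_near1 h (r : R) : 0 <= r < 1 ->
  (forall x, K x -> normc (1 - h x) <= r) ->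
  approximable h -> approximable (fun x => (h x)^-1).
Proof.
move=> /andP[r0 r1] hr ah; apply: approximable_lim => e e0.
have [n rn] : exists n, r ^+ n < e * (1 - r).
  by apply: exists_expr_lt; rewrite ?r0 ?mulr_gt0 // subr_gt0.
exists (fun x => \sum_(i < n) (1 + (- 1) * h x) ^+ i).
  apply: approximable_sumX; apply: approximable_add; first exact: approximable_cst.
  by apply: approximable_mul => //; exact: approximable_cst.
move=> x Kx; rewrite mulN1r.
have hx : 1 - r <= normc (h x).
  have := ler_normcD (1 - h x) (h x); rewrite subrK normc1.
  by have := hr x Kx; lra.
have hx0 : h x != 0 by apply: contraTneq hx => ->; rewrite normc0 -ltNge subr_gt0.
have -> : (h x)^-1 - \sum_(i < n) (1 - h x) ^+ i = (1 - h x) ^+ n / h x.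
  apply: (mulfI hx0); rewrite mulrBr divff // [in RHS]mulrC divfK //.
  have := subrX1 (1 - h x) n; rewrite addrAC subrr sub0r mulNr => E.
  by rewrite -[_ ^+ n](subrK 1) E addrC.
rewrite normcM normcV normcX ler_pdivrMr; last lra.
have rhx : e * (1 - r) <= e * normc (h x) by rewrite ler_pM2l.
apply: le_trans (_ : r ^+ n <= _); last lra.
by rewrite lerXn2r ?nnegrE ?normc_ge0 ?hr.
Qed.

Lemma normc_im (s : R) : normc (0 +i* s) = `|s|.
Proof. by rewrite /= expr0n add0r sqrtr_sqr. Qed.

(* From [1 / (w - i s)] with [s] large, obtained as a geometric series, one walks
   down the imaginary axis to [s = 0] in steps of length [d / 2]. *)
Lemma approximable_inv w (d : R) : 0 < d ->
  (forall x, K x -> d <= `|complex.Re (w x)|) ->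
  approximable w -> approximable (fun x => (w x)^-1).
Proof.
move=> d0 wd aw.
have half : 0 <= (2^-1 : R) < 1 by apply/andP; split; lra.
have wsd s x : K x -> d <= normc (w x - (0 +i* s)).
  move=> Kx; apply: le_trans (ler_Re_normc _).
  by move: (wd x Kx); case: (w x) => a b /=; rewrite oppr0 addr0.
have w0 s x : K x -> w x - (0 +i* s) != 0.
  move=> Kx; have := lt_le_trans d0 (wsd s x Kx).
  by apply: contraTneq => ->; rewrite normc0 ltxx.
pose P s := approximable (fun x => (w x - (0 +i* s))^-1).
have step s : P (s + d / 2) -> P s.
  move=> Ps.
  (* Here [w - i s = (w - i (s + d / 2)) h]. The last factor differs from 1 by at most
     [(d / 2) / d = 1 / 2], since subtracting an imaginary number leaves [|Re w| >= d] unchanged. *)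
  pose h x := 1 + (0 +i* (d / 2)) * (w x - (0 +i* (s + d / 2)))^-1.
  have ah : approximable h.
    apply: approximable_add; first exact: approximable_cst.
    by apply: approximable_mul => //; exact: approximable_cst.
  apply: (eq_approximable _ (approximable_mul Ps (approximable_inv_near1 half _ ah))) => x Kx.
    rewrite -invfM; congr _^-1; rewrite /h mulrDr mulr1 mulrCA divff ?w0 // mulr1.
    case: (w x) => a b; apply/eqP; rewrite eq_complex /=.
    by apply/andP; split; apply/eqP; ring.
  rewrite /h opprD addrA subrr sub0r normc_opp normcM normcV normc_im gtr0_norm; last lra.
  rewrite ler_pdivrMr; last by apply: lt_le_trans (wsd _ _ Kx).
  by have := wsd (s + d / 2) x Kx; lra.
have [M M0 wM] := approximable_bounded aw.
have big s : 2 * M <= s -> P s.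
  move=> Ms.
  have s0 : 0 < s by lra.
  have is0 : (0 +i* s) != 0 :> R[i].
    by apply: contraTneq s0 => -[->]; rewrite ltxx.
  (* Here [w - i s = (- i s) h] and [|1 - h| <= M / s <= 1 / 2]. *)
  pose h x := 1 + (- (0 +i* s)^-1) * w x.
  have ah : approximable h.
    apply: approximable_add; first exact: approximable_cst.
    by apply: approximable_mul => //; exact: approximable_cst.
  apply: (eq_approximable _ (approximable_mul (approximable_cst (- (0 +i* s)^-1))
    (approximable_inv_near1 half _ ah))) => x Kx.
    rewrite -invrN -invfM; congr _^-1; rewrite /h mulrDr mulr1 !mulNr mulrN opprK.
    by rewrite mulrA divff // mul1r addrC.
  rewrite /h opprD addrA subrr sub0r normc_opp mulNr normc_opp normcM normcV.
  rewrite normc_im gtr0_norm // mulrC ler_pdivrMr //.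
  by have := wM x Kx; lra.
have walk n s : P (s + n%:R * (d / 2)) -> P s.
  elim: n s => [|n IH] s; first by rewrite mul0r addr0.
  by move=> Ps; apply/step/IH; rewrite -addrA -{1}(mul1r (d / 2)) -mulrDl nat1r.
have P0 : P 0.
  have [n Mn] : exists n : nat, 2 * M / (d / 2) <= n%:R.
    by exists (Num.truncn (2 * M / (d / 2))).+1; rewrite ltW // truncnS_gt.
  apply: (walk n); apply: big; rewrite add0r -ler_pdivrMr //; lra.
by apply: (eq_approximable _ P0) => x _; rewrite subr0.
Qed.

Lemma approximable_sg w (d : R) : 0 < d ->
  (forall x, K x -> d <= `|complex.Re (w x)|) ->
  approximable w -> approximable (fun x => (Num.sg (complex.Re (w x)))%:C).
Proof.
move=> d0 wd aw.
pose u n x := iter n (fun v : R[i] => (v + v^-1) / 2%:R) (w x).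
pose s x := Num.sg (complex.Re (w x)).
(* The lower bound [d'] may shrink with [n]; it only serves to invert the current iterate. *)
have uP n : [/\ approximable (u n),
    exists2 d' : R, 0 < d' & forall x, K x -> d' <= `|complex.Re (u n x)| &
    forall x, K x -> Num.sg (complex.Re (u n x)) = s x].
  elim: n => [|n [au [d' d'0 ud'] us]]; first by split => //; exists d.
  have u0 x : K x -> complex.Re (u n x) != 0.
    by move=> Kx; rewrite -normr_gt0 (lt_le_trans d'0) ?ud'.
  split.
  - apply: approximable_mul; last exact: approximable_cst.
    by apply: approximable_add => //; exact: approximable_inv ud' au.
  - exists (d' / 2) => [|x Kx]; first lra.
    by have [] := Re_newton_step (u0 x Kx); have := ud' x Kx; rewrite /u /=; lra.
  - by move=> x Kx; rewrite -us //; have [] := Re_newton_step (u0 x Kx).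
have [M M0 wM] := approximable_bounded aw.
have [r /andP[r0 r1] rP] := newton_start M d0.
have s2 x : K x -> s x ^+ 2 = 1.
  by move=> Kx; rewrite /s sqr_sg -normr_gt0 (lt_le_trans d0) ?wd.
(* Squaring at each step would give the exponent [2^n]; [n.+1] suffices, as [n.+2 <= n.+1 * 2]. *)
have contract n x : K x ->
    normc (u n x - (s x)%:C) <= r ^+ n.+1 * normc (u n x + (s x)%:C).
  move=> Kx; elim: n => [|n IH]; first by rewrite expr1 rP ?wd ?wM.
  have [_ [d' d'0 /(_ x Kx) ud'] _] := uP n.
  have u0 : u n x != 0.
    by apply: complex_neq0_Re; rewrite -normr_gt0 (lt_le_trans d'0).
  apply: le_trans (newton_step_contract (s2 x Kx) u0 _ IH) _; first exact: exprn_ge0.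
  rewrite ler_wpM2r ?normc_ge0 // -exprM ler_wiXn2l // ?ltW //.
  by rewrite muln2 doubleS !ltnS -addnn leq_addl.
apply: approximable_lim => e e0.
(* With [N = |u - s|], contraction gives [N <= r^n (N + 2)]. The bound 1/2 absorbs the term in [N],
   leaving [N <= 4 r^n], which is below [e]. *)
have [n rn] : exists n, r ^+ n < Num.min (1 / 2) (e / 4).
  by apply: exists_expr_lt; rewrite ?r0 // lt_min; apply/andP; split; lra.
exists (u n) => [|x Kx]; first by have [] := uP n.
move: rn; rewrite lt_min => /andP[rn1 rn2].
have sn : normc (s x)%:C = 1 by rewrite normc_real -sqrtr_sqr s2 // sqrtr1.
rewrite -normc_opp opprB.
have := contract n x Kx.
have := ler_normcD (u n x - (s x)%:C) ((s x)%:C + (s x)%:C).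
rewrite addrA subrK; have := ler_normcD (s x)%:C (s x)%:C; rewrite sn.
set N := normc (u n x - _); set N' := normc (u n x + _) => h2 hN' hN.
have N0 : 0 <= N := normc_ge0 _.
have N'0 : 0 <= N' := normc_ge0 _.
have p0 : 0 <= r ^+ n by rewrite exprn_ge0.
have {}hN : N <= r ^+ n * N'.
  by apply: le_trans hN _; rewrite ler_wpM2r // exprS ler_piMl // ltW.
have hN2 : r ^+ n * N' <= r ^+ n * (N + 2) by rewrite ler_wpM2l //; lra.
have hN3 : r ^+ n * N <= 1 / 2 * N by rewrite ler_wpM2r // ltW.
lra.
Qed.

End Approximation.

(** * Uniform algebras and the sets [F_set A y] *)

Section UniformAlgebraTheory.
Variables (R : realType) (X : topologicalType) (A : set (X -> R[i]^o)).
Hypotheses (X_compact : compact [set: X]) (A_ua : is_uniform_algebra A).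

Lemma uniform_algebra_continuous_normc f x (e : R) : A f -> 0 < e ->
  \forall z \near x, normc (f x - f z) < e.
Proof.
move=> Af e0; have eC : 0 < e%:C :> R[i] by rewrite ltcR.
have := ua_continuous A_ua Af (x := x).
move=> /cvgrPdist_lt /(_ _ eC); apply: filterS => z /=.
by rewrite complex_normE ltcR.
Qed.

Lemma uniform_algebra_Re_continuous f : A f ->
  continuous (fun x => complex.Re (f x)).
Proof.
move=> Af x; apply/cvgrPdist_lt => e e0.
apply: filterS (uniform_algebra_continuous_normc x Af e0) => z; apply: le_lt_trans.
by rewrite -raddfB; exact: ler_Re_normc.
Qed.

Lemma uniform_algebra_bounded f : A f ->
  exists M : R, forall x, normc (f x) <= M.
Proof.
move=> Af; pose Q S := exists M : R, forall x, S x -> normc (f x) <= M.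
have [M fM] : Q [set: X]; last by exists M => x; exact: fM.
apply: compact_local_global => //.
- by exists 0.
- by move=> S S' SS' [M fM]; exists M => x /SS'; exact: fM.
- move=> S S' [M fM] [M' fM']; exists (Num.max M M') => x [/fM|/fM'] h;
  by rewrite le_max h ?orbT.
- move=> x; exists [set z | normc (f x - f z) < 1].
    exact: uniform_algebra_continuous_normc.
  exists (normc (f x) + 1) => z /= h.
  have := ler_normcD (f x) (- (f x - f z)).
  by rewrite normc_opp opprB addrCA subrr addr0; lra.
Qed.

Lemma uniform_algebra_lim f :
  (forall e : R, 0 < e ->
     exists2 g, A g & forall x, normc (f x - g x) <= e) -> A f.
Proof.
move=> fl; apply: (ua_closed A_ua) => W /uniform_nbhs[E [entE EW]].
move: entE; rewrite -entourage_from_ballE => -[d /= d0 dE].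
(* The radius of the entourage lives in [R[i]]; being positive, it is real. *)
have dR : d = (complex.Re d)%:C by rewrite RRe_real // gtr0_real.
have d'0 : 0 < complex.Re d by rewrite -ltcR -dR.
have d2 : 0 < complex.Re d / 2 by lra.
have [g Ag fg] := fl _ d2.
exists g; split => //; apply: EW => x _; apply: dE => /=.
rewrite -ball_normE /= dR complex_normE ltcR.
by apply: le_lt_trans (fg x) _; lra.
Qed.

(** The factor [f] vanishes where [h] is not controlled, so approximation of [h] on the support set
    becomes uniform approximation of the product on all of [X]. *)
Lemma uniform_algebra_mul_approximable f h :
  A f -> approximable A [set z | f z != 0] h -> A (fun x => f x * h x).
Proof.
move=> Af ah; apply: uniform_algebra_lim => e e0.
have [M fM] := uniform_algebra_bounded Af.
have M0 : 0 < `|M| + 1 by rewrite ltr_wpDl.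
have [g Ag hg] := ah _ (divr_gt0 e0 M0).
exists (fun x => f x * g x) => [|x]; first exact: (ua_mul A_ua).
rewrite -mulrBr normcM; have [->|fx0] := eqVneq (f x) 0.
  by rewrite normc0 mul0r ltW.
rewrite mulrC -(divfK (lt0r_neq0 M0) e) ler_pM ?normc_ge0 ?hg //.
by have := fM x; have := ler_norm M; lra.
Qed.

Lemma F_set_closed y : closed (F_set A y).
Proof.
move=> x clx f [Af fx0]; split => //.
(* A function vanishing near [x] also vanishes near every point close to [x], in particular near
   some [z] of [F_set A y]. *)
have [z [Fz fz0]] := clx _ (nbhs_interior fx0).
by have [] := Fz f.
Qed.

(* Compactness: a point off [F_set A y] has a neighbourhood on which some member of [A]
   not vanishing at [y] is zero; finitely many of them are multiplied together. *)
Lemma F_set_localizer (phi : X -> R) y :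
    continuous phi -> (forall z, F_set A y z -> phi z != 0) ->
  exists2 f, A f /\ f y != 0 &
    exists2 d : R, 0 < d & forall z, f z != 0 -> d <= `|phi z|.
Proof.
move=> cphi phi0.
pose Q S := exists2 f, A f /\ f y != 0 &
  exists2 d : R, 0 < d & forall z, S z -> f z != 0 -> d <= `|phi z|.
have [f Af [d d0 fd]] : Q [set: X]; last first.
  by exists f => //; exists d => // z; exact: fd.
apply: compact_local_global => //.
- by exists (fun=> 1); [split; [exact: (ua_cst A_ua 1)|exact: oner_neq0]|exists 1].
- by move=> S S' SS' [f Af [d d0 fd]]; exists f => //; exists d => // z /SS'; exact: fd.
- move=> S S' [f [Af fy] [d d0 fd]] [f' [Af' fy'] [d' d'0 fd']].
  exists (fun z => f z * f' z); first by split; [exact: (ua_mul A_ua)|rewrite mulf_neq0].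
  exists (Num.min d d') => [|z Sz]; first by rewrite lt_min d0.
  rewrite mulf_eq0 negb_or => /andP[fz f'z]; rewrite ge_min.
  case: Sz => Sz; first by rewrite fd.
  by rewrite (fd' z) ?orbT.
- move=> x; have [Fx|nFx] := pselect (F_set A y x).
    have px : 0 < `|phi x| / 2 by rewrite divr_gt0 // normr_gt0 phi0.
    exists [set z | `|phi x - phi z| < `|phi x| / 2].
      by have /cvgrPdist_lt/(_ _ px) := cphi x.
    exists (fun=> 1); first by split; [exact: (ua_cst A_ua 1)|exact: oner_neq0].
    exists (`|phi x| / 2) => // z /= h _.
    by have := ler_normD (phi x - phi z) (phi z); rewrite subrK; lra.
  have [f [Af fx0] fy] : exists2 f, ideal_J A x f & f y != 0.
    apply: contrapT => nf; apply: nFx => f Jf; split; first by case: Jf.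
    by apply: contrapT => /eqP fy; apply: nf; exists f.
  exists [set z | f z = 0] => //.
  by exists f => //; exists 1 => // z ->; rewrite eqxx.
Qed.

End UniformAlgebraTheory.

(** * The dichotomy for [F_set A y] *)

Theorem theorem4p6 (R : realType) (X : topologicalType)
    (X_compact : compact [set: X]) (X_hausdorff : hausdorff_space X)
    (A : set (X -> R[i]^o)) (A_ua : is_uniform_algebra A) (y : X) :
  point_of_continuity A y \/
  exists P : set X, [/\ P `<=` F_set A y, P !=set0 & perfect_set P].
Proof.
have Fy : F_set A y y by move=> f [Af fy]; split => //; exact: nbhs_singleton fy.
have [[x Fx xy]|nx] := pselect (exists2 x, F_set A y x & x <> y); last first.
  left; apply/seteqP; split => [x Fx|_ -> //].
  by apply: contrapT => xy; apply: nx; exists x.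
right.
have [g Ag [gx gy]] : exists2 g, A g & g x = 0 /\ g y = 1.
  have [h Ah hxy] := ua_separates A_ua xy.
  have hyx : h y - h x != 0 by rewrite subr_eq0; apply/eqP => /esym.
  exists (fun z => (h z + - h x) * (h y - h x)^-1).
    apply: (ua_mul A_ua); last exact: (ua_cst A_ua).
    by apply: (ua_add A_ua) => //; exact: (ua_cst A_ua).
  by rewrite subrr mul0r divff.
pose phi z := complex.Re (g z).
have cphi : continuous phi by exact: (uniform_algebra_Re_continuous A_ua).
have [itvF|nitvF] := pselect (`[0 : R, 1]%classic `<=` phi @` F_set A y).
  by apply: (perfect_subset_of_image_itv _ _ cphi _ ltr01) => //; exact: F_set_closed.
exfalso.
have [t [t0 t1] tF] : exists2 t : R, 0 <= t /\ t <= 1 &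
    forall z, F_set A y z -> phi z != t.
  apply: contrapT => nt; apply: nitvF => t; rewrite /= in_itv /= => /andP[t0 t1].
  apply: contrapT => tF; apply: nt; exists t => // z Fz.
  by apply/eqP => zt; apply: tF; exists z.
(* Both [x] and [y] lie in [F_set A y], where [phi] omits [t], so [t] is neither [phi x = 0] nor
   [phi y = 1]. Hence [Re w] is negative at [x] and positive at [y]. *)
pose w z := g z + (- t)%:C.
have Aw : A w by apply: (ua_add A_ua) => //; exact: (ua_cst A_ua).
have Rew z : complex.Re (w z) = phi z - t by rewrite /w /phi raddfD.
have cw : continuous (fun z => complex.Re (w z)).
  exact: (uniform_algebra_Re_continuous A_ua).
have [f [Af fy] [d d0 fd]] : exists2 f, A f /\ f y != 0 &
    exists2 d : R, 0 < d & forall z, f z != 0 -> d <= `|complex.Re (w z)|.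
  apply: (F_set_localizer X_compact A_ua cw) => z Fz.
  by rewrite Rew subr_eq0 tF.
pose s z : R[i] := (Num.sg (complex.Re (w z)))%:C.
pose K := [set z | f z != 0].
have Abnd a : A a -> exists M : R, forall z, K z -> normc (a z) <= M.
  by move=> /(uniform_algebra_bounded X_compact A_ua)[M aM]; exists M.
have acst c : approximable A K (fun=> c).
  by apply: approximable_in; exact: (ua_cst A_ua).
have asg : approximable A K s.
  apply: (approximable_sg (ua_cst A_ua) (ua_add A_ua) (ua_mul A_ua) Abnd d0) => //.
  exact: approximable_in.
have AfS : A (fun z => f z * (1 + s z)).
  apply: (uniform_algebra_mul_approximable X_compact A_ua Af).
  exact: (approximable_add (ua_add A_ua)).
(* The sign is -1 near [x], which kills the product there; at [y] it is 1, so the product takes the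
   value [2 f y]. *)
have Jx : ideal_J A x (fun z => f z * (1 + s z)).
  split => //.
  have wx : complex.Re (w x) < 0.
    have := tF x Fx; rewrite Rew /phi gx /= => t_neq0.
    by rewrite sub0r oppr_lt0 lt_neqAle t_neq0.
  have wnear : \forall z \near x, complex.Re (w z) < 0.
    exact: (cvgr_lt _ (cw x)) wx.
  apply: filterS wnear => z wz.
  by rewrite /s ltr0_sg // rmorphN1 subrr mulr0.
have [_ /eqP] := Fx _ Jx.
have wy : 0 < complex.Re (w y).
  have := tF y Fy; rewrite Rew /phi gy /= => t_neq1.
  by rewrite subr_gt0 lt_neqAle eq_sym t_neq1.
by rewrite /s gtr0_sg // mulf_eq0 (negbTE fy) /= -mulr2n pnatr_eq0.
Qed.
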